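(* Let $\{X_n\}$ be an adversarial Markov chain with data $(\mathcal{X},\eta,P,\pi,D,K,x_0)$ as in the context. Suppose: (A1) there are $M<\infty$ and a probability measure $\mu_*$ concentrated on $K_{2D}\setminus K_D$ such that $P(x,dz)\le M\,\mu_*(dz)$ for all $x\in K_D\setminus K$ and $z\in K_{2D}\setminus K_D$; and (A3) the set $K_{2D}\setminus K_D$ is small for $P$: there are a probability measure $\nu_*$ on $\mathcal{X}$, an $\epsilon>0$ and an $n_0\in\mathbf{N}$ such that $P^{n_0}(x,A)\ge\epsilon\,\nu_*(A)$ for all states $x\in K_{2D}\setminus K_D$ and all $A\in\mathcal{F}$. Suppose moreover that either (a) $\nu_*=\mu_*$, or (b) $P$ is reversible (with respect to $\pi$) and $\mu_*=\pi|_{K_{2D}\setminus K_D}$. Then $\{X_n\}$ is bounded in probability, i.e. $\lim_{L\to\infty}\sup_{n\in\mathbf{N}}\mathbf{P}(\eta(X_n,\mathbf{0})>L\mid X_0=x_0)=0$.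
   Context: Adversarial Markov chain: $\mathcal{X}$ is a nonempty state space with a metric $\eta$, its Borel $\sigma$-algebra $\mathcal{F}$, and a specified origin point $\mathbf{0}\in\mathcal{X}$. $P$ is the transition kernel of a time-homogeneous Markov chain on $\mathcal{X}$ which is Harris ergodic with stationary probability distribution $\pi$: $\lim_{n\to\infty}\sup_{A\in\mathcal{F}}|P^n(x,A)-\pi(A)|=0$ for every $x\in\mathcal{X}$. There is a constant $D<\infty$ with $P(x,\{y\in\mathcal{X}:\eta(x,y)\le D\})=1$ for all $x\in\mathcal{X}$. $K\in\mathcal{F}$ is a fixed bounded nonempty subset; for $r>0$, $K_r$ is the set of all states within distance $r$ of $K$. The adversarial Markov chain is a stochastic process $\{X_n\}_{n\ge 0}$ with $X_0=x_0$ for a specific $x_0\in K$ such that: (i) whenever $X_n\notin K$, $\mathbf{P}(X_{n+1}\in A\mid X_0,\dots,X_n)=P(X_n,A)$ for all $A\in\mathcal{F}$; (ii) when $X_n\in K$ it may move arbitrarily according to an adversary, possibly depending on $n$ and on the history $X_0,\dots,X_n$ in a nonanticipatory manner, subject only to measurability (the conditional probabilities are well defined) and to the restriction that it cannot move more than a distance $D$ at each iteration, or more specifically that from $K$ it can only move to points of $K_D$. The inequality in (A1) means $P(x,A)\le M\mu_*(A)$ for all measurable $A\subseteq K_{2D}\setminus K_D$ and all $x\in K_D\setminus K$. For a set $B$, $\pi|_B$ denotes the normalized restriction $\pi|_B(A)=\pi(A\cap B)/\pi(B)$.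
   Formalization: The formal theorem additionally assumes π(K_{2D}∖K_D) > 0; in case (b) this is what makes π|_{K_{2D}∖K_D} defined, while in case (a) the claim is false without it (e.g. π a point mass at an absorbing state of K, with excursions of infinite mean length). *)

(* Defs.v *)
From HB Require Import structures.
From mathcomp Require Import all_boot all_order all_algebra.
From mathcomp Require Import all_classical all_reals all_analysis.

Set Implicit Arguments.
Unset Strict Implicit.
Unset Printing Implicit Defensive.

Import Order.TTheory GRing.Theory Num.Theory.
Import numFieldNormedType.Exports.

Local Open Scope classical_set_scope.
Local Open Scope ring_scope.
Local Open Scope ereal_scope.

(* [measurableType] requires a pointed carrier, which [metricType] does not
   provide; the point plays no role beyond nonemptiness. *)
#[short(type="pmetricType")]
HB.structure Definition PointedMetric (K : numDomainType) :=
  { M of Metric K M & Pointed M }.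

Notation borel T := (g_sigma_algebraType (@open T)).

Section metric_sets.
Context {R : realType} {T : pmetricType R}.

(* The distance from x to K is the infimum of the distances to the points of K,
   so this set is closed, hence Borel. Meaningful for nonempty K only, as
   [inf set0 = 0]. *)
Definition thickening (K : set T) (r : R) : set T :=
  [set x | (inf [set mdist x y | y in K] <= r)%R].

Definition shell (K : set T) (r s : R) : set T :=
  thickening K s `\` thickening K r.

Definition metric_bounded (K : set T) : Prop :=
  exists r : R, forall x y, K x -> K y -> (mdist x y <= r)%R.

End metric_sets.

Section markov_kernels.
Context {d : measure_display} {T : measurableType d} {R : realType}.
Variables (P : R.-pker T ~> T) (pi : probability T R).

Fixpoint kernel_iter (n : nat) (x : T) (A : set T) : \bar R :=
  if n is m.+1 then \int[P x]_y kernel_iter m y A else \d_x A.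

Definition stationary : Prop :=
  forall A, measurable A -> \int[pi]_x P x A = pi A.

Definition harris_ergodic : Prop :=
  stationary /\
  forall x, (fun n => ereal_sup
    [set `|kernel_iter n x A - pi A| | A in measurable]) @ \oo --> 0.

Definition reversible : Prop :=
  forall A B, measurable A -> measurable B ->
    \int[pi]_(x in A) P x B = \int[pi]_(x in B) P x A.

Definition normalized_restriction (B A : set T) : \bar R :=
  (fine (pi (A `&` B)) / fine (pi B))%:E.

Definition small_with (C : set T) (nu : probability T R) : Prop :=
  exists2 eps : R, (0 < eps)%R &
  exists n0 : nat, forall x A, C x -> measurable A ->
    eps%:E * nu A <= kernel_iter n0 x A.

End markov_kernels.

Section adversarial.
Context {d : measure_display} {Omega : measurableType d} {R : realType}.
Variable Pr : probability Omega R.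

(* f is a version of the conditional probability of E given the sub-sigma-algebra
   G of the sigma-algebra of Omega *)
Definition is_cond_prob (G : set (set Omega)) (E : set Omega)
    (f : Omega -> R) : Prop :=
  [/\ forall B : set R, measurable B -> G (f @^-1` B),
      Pr.-integrable setT (EFin \o f) &
      forall H, G H -> \int[Pr]_(w in H) (f w)%:E = Pr (E `&` H)].

Context {T : pmetricType R}.

Definition history (X : nat -> {RV Pr >-> borel T}) (n : nat) :
    set (set Omega) :=
  g_sigma_preimage (fun i : 'I_n.+1 => X i : Omega -> borel T).

(* The law of the move out of K is constrained by the support condition only:
   it may depend on n, on the history and on additional randomness. *)
Record adversarial_chain (P : R.-pker (borel T) ~> (borel T)) (D : R)
    (K : set T) (x0 : T) (X : nat -> {RV Pr >-> borel T}) : Prop := {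
  adv_init : {ae Pr, forall w, X 0%N w = x0};
  adv_outside : forall (n : nat) (A : set (borel T)), measurable A ->
    exists2 f : Omega -> R,
      is_cond_prob (history X n) (X n.+1 @^-1` A) f &
      {ae Pr, forall w, ~ K (X n w) -> (f w)%:E = P (X n w) A};
  adv_inside : forall n : nat,
    {ae Pr, forall w, K (X n w) -> thickening K D (X n.+1 w)} }.

Definition bounded_in_probability (origin : T)
    (X : nat -> {RV Pr >-> borel T}) : Prop :=
  (fun L : R => ereal_sup
    (range (fun n => Pr [set w | (L < mdist (X n w : T) origin)%R])))
  @ +oo%R --> 0.

End adversarial.

(* Main.v *)
Require Import Defs.
From mathcomp Require Import all_boot all_order all_algebra.
From mathcomp Require Import all_classical all_reals all_analysis.
From mathcomp Require Import finmap measurable_realfun.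
From mathcomp Require Import ring lra.

Set Implicit Arguments.
Unset Strict Implicit.
Unset Printing Implicit Defensive.

Import Order.TTheory GRing.Theory Num.Theory.
Import numFieldNormedType.Exports.

Local Open Scope classical_set_scope.
Local Open Scope ring_scope.
Local Open Scope ereal_scope.

(** Write [B] for the set of points within [D] of [K], [C] for the shell around
    it, and consider the last visit to [B] before a time [n] at which the chain
    is far away. At that visit, at time [k] say, the chain is in [B] but not in
    [K], hence moves by [P], and it lands in [C] with law at most [M mu]. From
    then on it stays off [K] and follows [P] without meeting [B]. Whatever the
    adversary does, each possible [k] therefore contributes at most [M] times
    the probability that the chain started from [mu] has avoided [B] for
    [j = n - k - 1] steps and is then far away ([last_exit_sum],
    [excursion_le]). It remains to bound the sum over [k] uniformly in [n].

    Alternative (b) reduces to alternative (a): by reversibility, the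
    normalized restriction of [pi] to a small set is itself a small measure
    ([reversible_small]). So [mu] may be assumed small, and then it is dominated
    by a multiple of [pi] ([small_dominated]). By stationarity the same holds
    of the law of the chain started from [mu] at every later time, so that each
    single term is at most a constant times [pi] of the far region, which tends
    to 0. Only the tail of the sum has to be controlled.

    If [pi B > 0], the chain started from the small measure [mu] reaches [B] in
    finite mean time ([small_measure_hitting]). This is a consequence of Kac's
    bound on return times to [B] ([kac_bound]): with positive probability the
    stationary chain is first in [B], later in [C] by ergodicity, and then
    distributed as [mu] by smallness; a large mean hitting time from [mu] would
    make the mean time from [B] back to [B] large as well. The terms are then
    summable in the duration [j].

    If [pi B = 0], the domination of [mu] by [pi] shows that an excursion almost
    surely never returns to [B]. The excursions are then disjoint events, and
    their probabilities are summable in the starting time [k]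
    ([tight_of_few_excursions]). *)

(** * Nonnegative measurable functions *)

Section nonnegative_measurable_functions.
Context d (T : measurableType d) (R : realType).
Implicit Types (f g : T -> \bar R) (A : set T).

Definition nnmeas f := measurable_fun setT f /\ forall x, 0 <= f x.

Definition ind A : T -> \bar R := fun x => (\1_A x)%:E.

Lemma nnmeas_ind A : measurable A -> nnmeas (ind A).
Proof.
by move=> mA; split=> [|x]; [exact/measurable_EFinP|rewrite lee_fin].
Qed.

Lemma nnmeas_cst (c : \bar R) : 0 <= c -> nnmeas (fun=> c).
Proof. by move=> c0; split=> //; exact: measurable_cst. Qed.

Lemma nnmeasD f g : nnmeas f -> nnmeas g -> nnmeas (fun x => f x + g x).
Proof.
move=> [mf f0] [mg g0]; split=> [|x]; first exact: emeasurable_funD.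
exact: adde_ge0.
Qed.

Lemma nnmeasM f g : nnmeas f -> nnmeas g -> nnmeas (fun x => f x * g x).
Proof.
move=> [mf f0] [mg g0]; split=> [|x]; first exact: emeasurable_funM.
exact: mule_ge0.
Qed.

Lemma nnmeas_sum I (s : seq I) (f : I -> T -> \bar R) :
  (forall i, nnmeas (f i)) -> nnmeas (fun x => \sum_(i <- s) f i x).
Proof.
move=> nf; split=> [|x].
  by apply: emeasurable_sum => i; have [] := nf i.
by apply: sume_ge0 => i _; have [] := nf i.
Qed.

Lemma integral_ind (m : {measure set T -> \bar R}) A :
  measurable A -> \int[m]_x ind A x = m A.
Proof. by move=> mA; rewrite integral_indic// setIT. Qed.

Lemma integral_prob_cst (m : probability T R) (c : \bar R) :
  \int[m]_x c = c.
Proof.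
by rewrite integral_cst// -[RHS]mule1 -(@probability_setT _ _ _ m).
Qed.

Lemma integral_scale (m : {measure set T -> \bar R}) (k : \bar R) f :
  0 <= k -> nnmeas f -> \int[m]_x (k * f x) = k * \int[m]_x f x.
Proof. by move=> k0 [mf f0]; rewrite ge0_integralZl. Qed.

Lemma ind_mul_patch A f : (fun x => ind A x * f x) = f \_ A.
Proof. by rewrite epatch_indic; apply/funext => x /=; rewrite muleC. Qed.

Lemma integral_ind_mul (m : {measure set T -> \bar R}) A f :
  \int[m]_(x in A) f x = \int[m]_x (ind A x * f x).
Proof. by rewrite integral_mkcond -ind_mul_patch. Qed.

Lemma ind_in A x : A x -> ind A x = 1.
Proof. by move=> Ax; rewrite /ind indicE mem_set. Qed.

Lemma ind_notin A x : ~ A x -> ind A x = 0.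
Proof. by move=> Ax; rewrite /ind indicE memNset. Qed.

Lemma ind_mulI A B x : ind A x * ind B x = ind (A `&` B) x.
Proof. by rewrite /ind indicI EFinM. Qed.

Lemma ind_mul_le A f x : 0 <= f x -> ind A x * f x <= f x.
Proof.
move=> f0; have [Ax|Ax] := pselect (A x); first by rewrite ind_in ?mul1e.
by rewrite ind_notin ?mul0e.
Qed.

Lemma ind_le1 A x : ind A x <= 1.
Proof. by rewrite /ind indicE lee_fin lern1 leq_b1. Qed.

Lemma ind_add_setC A f x : f x = ind A x * f x + ind (~` A) x * f x.
Proof.
have [Ax|Ax] := pselect (A x).
  by rewrite ind_in // ind_notin ?mul1e ?mul0e ?adde0 // => /(_ Ax).
by rewrite ind_notin // ind_in // mul1e mul0e add0e.
Qed.

End nonnegative_measurable_functions.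
Arguments ind {d T R} A x.

(** * Functionals determined by their values on indicators *)

Section daniell_functionals.
Context d (T : measurableType d) (R : realType).
Implicit Types (f g : T -> \bar R) (A : set T).

(** The defining properties of an integral in the sense of Daniell. Kernel
    iterates, killed kernels and expectations of functions of a random state
    all share them, so an identity or inequality between two such functionals
    needs to be checked on indicators only. *)
Record daniell (Phi : (T -> \bar R) -> \bar R) : Prop := Daniell {
  daniell_mono : forall f g, nnmeas f -> nnmeas g ->
    (forall x, f x <= g x) -> Phi f <= Phi g ;
  daniellD : forall f g, nnmeas f -> nnmeas g ->
    Phi (fun x => f x + g x) = Phi f + Phi g ;
  daniellZ : forall (a : R) f, (0 <= a)%R -> nnmeas f ->
    Phi (fun x => a%:E * f x) = a%:E * Phi f ;
  daniell_cvg : forall f : nat -> T -> \bar R, (forall n, nnmeas (f n)) ->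
    (forall x, nondecreasing_seq (f ^~ x)) ->
    Phi (f n) @[n --> \oo] --> Phi (fun x => limn (f ^~ x)) }.

Lemma daniell0 Phi : daniell Phi -> Phi (fun=> 0) = 0.
Proof.
move=> dPhi; rewrite -[RHS](mul0e (Phi (fun=> 0))) -daniellZ//.
by congr Phi; apply/funext => x; rewrite mul0e.
Qed.

Lemma daniell_ge0 Phi f : daniell Phi -> nnmeas f -> 0 <= Phi f.
Proof.
move=> dPhi nf; rewrite -(daniell0 dPhi); apply: daniell_mono => //.
exact: nf.2.
Qed.

Lemma daniell_sum Phi I (s : seq I) (f : I -> T -> \bar R) : daniell Phi ->
  (forall i, nnmeas (f i)) ->
  Phi (fun x => \sum_(i <- s) f i x) = \sum_(i <- s) Phi (f i).
Proof.
move=> dPhi nf; elim: s => [|i s IH].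
  rewrite big_nil; under eq_fun do rewrite big_nil.
  exact: daniell0.
rewrite big_cons -IH -daniellD//; last exact: nnmeas_sum.
by congr Phi; apply/funext => x; rewrite big_cons.
Qed.

Import HBNNSimple.

Lemma daniell_nnsfun Phi (f : {nnsfun T >-> R}) : daniell Phi ->
  let s := enum_fset (fset_set (range f)) in
  Phi (EFin \o f) =
  \sum_(i < size s) (s`_i)%:E * Phi (ind (f @^-1` [set s`_i])).
Proof.
move=> dPhi s; have s0 (i : 'I_(size s)) : (0 <= s`_i)%R.
  have : s`_i \in fset_set (range f) by exact: mem_nth.
  by rewrite in_fset_set// => /set_mem[x _ <-].
have mA (i : 'I_(size s)) : measurable (f @^-1` [set s`_i]) by [].
transitivity (Phi (fun x =>
    \sum_(i < size s) (s`_i)%:E * ind (f @^-1` [set s`_i]) x)).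
  congr Phi; apply/funext => x /=; rewrite fimfunEord -sumEFin.
  by apply: eq_bigr => i _; rewrite EFinM.
rewrite daniell_sum// => [|i].
  by apply: eq_bigr => i _; rewrite daniellZ//; exact: nnmeas_ind.
apply: nnmeasM; last exact: nnmeas_ind.
by apply: nnmeas_cst; rewrite lee_fin.
Qed.

(** Linearity carries the comparison from indicators to simple functions, and
    monotone convergence along an increasing approximation to all of them. *)
Lemma daniell_le Phi Psi f : daniell Phi -> daniell Psi ->
  (forall A, measurable A -> Phi (ind A) <= Psi (ind A)) ->
  nnmeas f -> Phi f <= Psi f.
Proof.
move=> dPhi dPsi le_ind [mf f0].
pose g := nnsfun_approx measurableT mf.
have ng n : nnmeas (EFin \o g n).
  by split=> [|x /=]; [exact/measurable_EFinP|rewrite lee_fin].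
have ndg x : nondecreasing_seq (fun n => (EFin \o g n) x).
  by move=> m n mn; rewrite lee_fin; exact/lefP/nd_nnsfun_approx.
have fE : f = fun x => limn (fun n => (EFin \o g n) x).
  apply/funext => x; apply/esym/cvg_lim => //.
  by apply: cvg_nnsfun_approx => // y _.
have Phig := daniell_cvg dPhi ng ndg; have Psig := daniell_cvg dPsi ng ndg.
rewrite fE; rewrite -(cvg_lim _ Phig)// -(cvg_lim _ Psig)//.
apply: lee_lim; [by apply/cvg_ex; eexists; exact: Phig|
  by apply/cvg_ex; eexists; exact: Psig|].
apply: nearW => n; rewrite !daniell_nnsfun//; set s := enum_fset _.
apply: lee_sum => i _.
apply: lee_wpmul2l; last exact: le_ind.
have : s`_i \in fset_set (range (g n)) by exact: mem_nth.
by rewrite in_fset_set// => /set_mem[x _ <-]; rewrite lee_fin.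
Qed.

Lemma daniell_eq Phi Psi f : daniell Phi -> daniell Psi ->
  (forall A, measurable A -> Phi (ind A) = Psi (ind A)) ->
  nnmeas f -> Phi f = Psi f.
Proof.
move=> dPhi dPsi eq_ind nf; apply/le_anti/andP; split;
  by apply: daniell_le => // A mA; rewrite eq_ind.
Qed.

Lemma daniell_integral (m : {measure set T -> \bar R}) D : measurable D ->
  daniell (fun f => \int[m]_(x in D) f x).
Proof.
move=> mD; have mS f : nnmeas f -> measurable_fun D f.
  by move=> [mf _]; exact: measurable_funTS.
split=> [f g nf ng fg|f g nf ng|a f a0 nf|f nf ndf].
- by apply: ge0_le_integral => //; (exact: mS || (move=> *; exact: nf.2)).
- by rewrite ge0_integralD//;
    (exact: mS || (move=> *; exact: nf.2) || (move=> *; exact: ng.2)).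
- by rewrite ge0_integralZl_EFin//; (exact: mS || (move=> *; exact: nf.2)).
- apply: cvg_monotone_convergence => // [n|n x _]; first exact: mS.
  exact: (nf n).2.
Qed.

Lemma daniell_scale Phi (a : R) : (0 <= a)%R -> daniell Phi ->
  daniell (fun f => a%:E * Phi f).
Proof.
move=> a0 dPhi; split=> [f g nf ng fg|f g nf ng|b f b0 nf|f nf ndf].
- by apply: lee_wpmul2l; [rewrite lee_fin|exact: daniell_mono].
- by rewrite daniellD// ge0_muleDr//; exact: daniell_ge0.
- by rewrite daniellZ// muleCA.
- by apply: cvgeZl => //; exact: daniell_cvg.
Qed.

Lemma daniell_eval x : daniell (fun f => f x).
Proof.
split=> // f nf ndf; exact: ereal_nondecreasing_is_cvgn.
Qed.

End daniell_functionals.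

Section positive_operators.
Context d (T : measurableType d) (R : realType).
Implicit Types (f g w : T -> \bar R) (U V : (T -> \bar R) -> T -> \bar R).

(** The operators on functions that transition kernels and multiplications by
    a weight induce; composing one with a Daniell functional gives another
    such functional. *)
Definition positive_op U := (forall f, nnmeas f -> nnmeas (U f)) /\
  (forall x, daniell (U ^~ x)).

Lemma daniell_op Phi U : daniell Phi -> positive_op U -> daniell (Phi \o U).
Proof.
move=> dPhi [nU dU]; split=> [f g nf ng fg|f g nf ng|a f a0 nf|f nf ndf] /=.
- by apply: daniell_mono => // [||x]; [exact: nU|exact: nU|
    exact: daniell_mono (dU x) _ _ _ _ _].
- rewrite -daniellD//; [|exact: nU|exact: nU]; congr Phi; apply/funext => x.
  exact: daniellD (dU x) _ _ _ _.
- rewrite -daniellZ//; last exact: nU.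
  by congr Phi; apply/funext => x; exact: daniellZ (dU x) _ _ _ _.
- have -> : U (fun x => limn (f ^~ x)) = fun x => limn (fun n => U (f n) x).
    apply/funext => x; apply/esym/cvg_lim => //.
    exact: daniell_cvg (dU x) _ _ _.
  apply: (daniell_cvg dPhi (f := fun n => U (f n))) => [n|x m n mn].
    exact: nU.
  by apply: (daniell_mono (dU x)) => // y; exact: ndf.
Qed.

Lemma positive_op_comp U V : positive_op U -> positive_op V ->
  positive_op (U \o V).
Proof.
move=> pU pV; split=> [f nf|x]; first exact/pU.1/pV.1.
exact: daniell_op (pU.2 x) pV.
Qed.

Lemma positive_op_id : positive_op id.
Proof. by split=> // x; exact: daniell_eval. Qed.

Lemma positive_op_iter U n : positive_op U -> positive_op (iter n U).
Proof.
move=> pU; elim: n => [|n IH]; first exact: positive_op_id.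
exact: positive_op_comp pU IH.
Qed.

Lemma positive_op_mul w : nnmeas w -> positive_op (fun f x => w x * f x).
Proof.
move=> nw; split=> [f nf|x]; first exact: nnmeasM.
split=> [f g nf ng fg|f g nf ng|b f b0 nf|f nf ndf].
- by apply: lee_wpmul2l => //; exact: nw.2.
- by rewrite ge0_muleDr//; [exact: nf.2|exact: ng.2].
- by rewrite muleCA.
- have cf : f n x @[n --> \oo] --> limn (f ^~ x).
    exact: ereal_nondecreasing_is_cvgn.
  have [wfin|] := boolP (w x \is a fin_num); first exact: cvgeZl.
  (* an infinite weight commutes with the limit except possibly when the limit
     is 0, and then the whole sequence vanishes *)
  rewrite ge0_fin_numE ?nw.2// -leNgt leye_eq => /eqP ->.
  have [l0|l0] := eqVneq (limn (f ^~ x)) 0; last first.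
    by apply: cvgeM => //; [exact: mule_def_infty_neq0|exact: cvg_cst].
  have f0 n : f n x = 0.
    apply/le_anti/andP; split; last exact: (nf n).2.
    rewrite -l0; apply: lime_ge; first exact: ereal_nondecreasing_is_cvgn.
    by exists n => // m /= nm; exact: ndf.
  by rewrite l0 mule0; under eq_fun do rewrite f0 mule0; exact: cvg_cst.
Qed.

End positive_operators.

(** * The transition operator, stationarity and reversibility *)

Section kernel_operator.
Context d (T : measurableType d) (R : realType).
Implicit Types (f g : T -> \bar R) (A B : set T).
Variable P : R.-pker T ~> T.

Definition kernel_op f x := \int[P x]_y f y.

Lemma positive_kernel_op : positive_op kernel_op.
Proof.
split=> [f [mf f0]|x]; last exact: daniell_integral.
split=> [|x]; last exact: integral_ge0.
by apply: measurable_fun_integral_kernel => // A mA; exact: measurable_kernel.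
Qed.

Lemma kernel_op_cst (c : \bar R) x : kernel_op (fun=> c) x = c.
Proof. by rewrite /kernel_op integral_cst// prob_kernel mule1. Qed.

Lemma kernel_op_ind A x : measurable A -> kernel_op (ind A) x = P x A.
Proof. exact: integral_ind. Qed.

Lemma kernel_full_setC x A : measurable A -> P x (~` A) = 1 -> P x A = 0.
Proof.
move=> mA PA; have := @prob_kernel _ _ _ _ _ P x.
rewrite -(setUv A) measureU ?setICr//; last exact: measurableC.
rewrite [X in _ + X]PA => PAD1.
by rewrite -[LHS](@addeK _ 1)// [X in X - _]PAD1 subee.
Qed.

Lemma kernel_iterE n x A : kernel_iter P n x A = iter n kernel_op (ind A) x.
Proof.
elim: n x => [//|n IH] x /=; rewrite {2}/kernel_op.
by apply: eq_integral => y _; exact: IH.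
Qed.

Let pos_iter n : positive_op (iter n kernel_op).
Proof. exact: positive_op_iter positive_kernel_op. Qed.

Lemma iter_kernel_op_cst n (c : \bar R) x : iter n kernel_op (fun=> c) x = c.
Proof.
elim: n x => [//|n IH] x /=.
by rewrite (_ : iter n _ _ = fun=> c) ?kernel_op_cst//; apply/funext.
Qed.

Lemma nnmeas_iter_kernel_op n f : nnmeas f -> nnmeas (iter n kernel_op f).
Proof. exact: (pos_iter n).1. Qed.

Lemma iter_kernel_op_mono n f g x : nnmeas f -> nnmeas g ->
  (forall y, f y <= g y) -> iter n kernel_op f x <= iter n kernel_op g x.
Proof. exact: daniell_mono ((pos_iter n).2 x) _ _. Qed.

Section stationary.
Variable pi : probability T R.
Hypothesis stat : stationary P pi.

Lemma stationary_integral n f : nnmeas f ->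
  \int[pi]_x iter n kernel_op f x = \int[pi]_x f x.
Proof.
elim: n => [//|n IH] nf; rewrite -[RHS]IH//=.
have := nnmeas_iter_kernel_op n nf; move: (iter _ _ _) => {f nf IH}f nf.
apply: (daniell_eq (Phi := fun f => \int[pi]_x kernel_op f x)) nf => //.
- exact: daniell_op (daniell_integral _ measurableT) positive_kernel_op.
- exact: daniell_integral.
- move=> A mA; rewrite [RHS]integral_ind// -[RHS](stat mA).
  by apply: eq_integral => x _; rewrite kernel_op_ind.
Qed.

End stationary.

Section reversible.
Variable pi : probability T R.
Hypothesis rev : reversible P pi.

Let daniell_bilinear g : nnmeas g ->
  daniell (fun f => \int[pi]_x (g x * kernel_op f x)).
Proof.
move=> ng; apply: daniell_op (daniell_integral pi measurableT) _.
exact: positive_op_comp (positive_op_mul ng) positive_kernel_op.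
Qed.

Let daniell_weight g : nnmeas g -> daniell (fun f => \int[pi]_x (f x * g x)).
Proof.
move=> ng; under eq_fun do under eq_integral do rewrite muleC.
exact: daniell_op (daniell_integral pi measurableT) (positive_op_mul ng).
Qed.

(** Reversibility is symmetry of a bilinear form on indicators; it extends to
    functions in one argument at a time. *)
Lemma reversible_integral f g : nnmeas f -> nnmeas g ->
  \int[pi]_x (g x * kernel_op f x) = \int[pi]_x (f x * kernel_op g x).
Proof.
have nU h : nnmeas h -> nnmeas (kernel_op h) by exact: positive_kernel_op.1.
move=> nf ng.
apply: (daniell_eq (daniell_weight (nU _ nf)) (daniell_bilinear nf)) ng.
move=> A mA; have nA := nnmeas_ind R mA.
apply: (daniell_eq (daniell_bilinear nA) (daniell_weight (nU _ nA))) nf.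
move=> B mB; rewrite -!integral_ind_mul.
have kE C D' : measurable C ->
    \int[pi]_(x in D') kernel_op (ind C) x = \int[pi]_(x in D') P x C.
  by move=> mC; apply: eq_integral => x _; rewrite kernel_op_ind.
by rewrite !kE//; exact: rev.
Qed.

Lemma reversible_integral_iter n f g : nnmeas f -> nnmeas g ->
  \int[pi]_x (g x * iter n kernel_op f x) =
  \int[pi]_x (f x * iter n kernel_op g x).
Proof.
elim: n f g => [|n IH] f g nf ng.
  by apply: eq_integral => x _ /=; rewrite muleC.
rewrite iterS iterSr reversible_integral//; last exact: nnmeas_iter_kernel_op.
under eq_integral do rewrite muleC.
by rewrite IH//; exact: positive_kernel_op.1.
Qed.

End reversible.

End kernel_operator.

Lemma bounded_ge0_fin (R : realType) (x : \bar R) (r : R) :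
  0 <= x -> x <= r%:E -> exists2 s : R, (0 <= s)%R & x = s%:E.
Proof.
by case: x => [s||]//=; rewrite lee_fin => s0 _; exists s.
Qed.

(** * Small sets *)

Section small_sets.
Context d (T : measurableType d) (R : realType).
Implicit Types (f g : T -> \bar R) (A B : set T).
Variables (P : R.-pker T ~> T) (pi nu : probability T R).
Variables (C : set T) (eps : R) (n0 : nat).
Hypothesis mC : measurable C.
Hypothesis eps_gt0 : (0 < eps)%R.
Hypothesis C_small : forall x A, C x -> measurable A ->
  eps%:E * nu A <= kernel_iter P n0 x A.

Let U := kernel_op P.
Let pos_iter n : positive_op (iter n U).
Proof. exact: positive_op_iter (positive_kernel_op P). Qed.

Lemma small_integral f x : nnmeas f -> C x ->
  eps%:E * \int[nu]_y f y <= iter n0 U f x.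
Proof.
move=> nf Cx.
apply: (daniell_le (daniell_scale (ltW eps_gt0)
  (daniell_integral nu measurableT)) ((pos_iter n0).2 x)) nf.
by move=> A mA; rewrite integral_ind// -kernel_iterE C_small.
Qed.

(** Stationarity lets [n0] steps pass for free, and the mass that [pi] puts on
    [C] is then spread at least as [nu]: a small measure is dominated by a
    multiple of the stationary one. *)
Lemma small_stationary f : stationary P pi -> nnmeas f ->
  eps%:E * pi C * \int[nu]_y f y <= \int[pi]_y f y.
Proof.
move=> stat nf; rewrite -(stationary_integral stat n0 nf).
have nUf := (pos_iter n0).1 _ nf.
have nu0 : 0 <= \int[nu]_y f y by apply: integral_ge0 => y _; exact: nf.2.
have e0 : 0 <= eps%:E * \int[nu]_y f y.
  by rewrite mule_ge0// lee_fin ltW.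
rewrite muleAC -integral_ind//.
have dpi := daniell_integral pi measurableT.
rewrite -integral_scale//; last exact: nnmeas_ind.
apply: (daniell_mono dpi) => //.
  by apply: nnmeasM; [exact: nnmeas_cst|exact: nnmeas_ind].
move=> y; have [Cy|Cy] := pselect (C y).
  by rewrite ind_in// mule1; exact: small_integral.
by rewrite ind_notin// mule0; exact: nUf.2.
Qed.

End small_sets.

Section small_set_domination.
Context d (T : measurableType d) (R : realType).
Variables (P : R.-pker T ~> T) (pi mu : probability T R).

Lemma small_dominated C : stationary P pi -> measurable C -> 0 < pi C ->
  small_with P C mu -> exists2 G : R, (0 <= G)%R & forall f j, nnmeas f ->
    \int[mu]_x iter j (kernel_op P) f x <= G%:E * \int[pi]_x f x.
Proof.
move=> stat mC piC [eps eps0 [n0 C_small]].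
pose q := fine (pi C); have qE : pi C = q%:E by rewrite fineK ?fin_num_measure.
have q0 : (0 < q)%R by rewrite -lte_fin -qE.
exists (eps * q)^-1%R; first by rewrite invr_ge0 mulr_ge0// ltW.
move=> f j nf; rewrite -(stationary_integral stat j nf).
have nUf := nnmeas_iter_kernel_op P j nf.
apply: (@le_trans _ _ ((eps * q)^-1%:E *
  (eps%:E * pi C * \int[mu]_x iter j (kernel_op P) f x))).
  by rewrite qE muleA -!EFinM mulVf ?mul1e// gt_eqF// mulr_gt0.
apply: lee_wpmul2l; first by rewrite lee_fin invr_ge0 mulr_ge0// ltW.
exact: small_stationary mC eps0 C_small _ stat nUf.
Qed.

End small_set_domination.

Section reversible_small_sets.
Context d (T : measurableType d) (R : realType).
Variables (P : R.-pker T ~> T) (pi nu : probability T R).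
Variable C : set T.
Hypothesis mC : measurable C.

(** For a reversible chain the restriction of [pi] to a small set is itself a
    small measure, after twice as many steps. With a density [h] of [nu] with
    respect to [pi], reversibility makes [eps h] a lower bound of the density
    of both the [n0] steps leaving [C] and the [n0] steps ending in [C], and
    [\int h^2 dpi >= 1] by the Cauchy-Schwarz inequality. The proof avoids
    densities at the cost of a factor 4: for [A] in [C], the function
    [g y = P^n0 (y, A)] satisfies [\int_E g dpi >= eps nu(E) pi(A)] for every
    [E], so that the set where [g] is below [eps pi(A) / 2] has
    [nu]-probability at most 1/2, whence [\int g dnu >= eps pi(A) / 4]. *)
Lemma reversible_small (mu : probability T R) : reversible P pi ->
  (0 < pi C) ->
  (forall A, measurable A -> mu A = normalized_restriction pi C A) ->
  small_with P C nu -> small_with P C mu.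
Proof.
move=> rev piC muE [eps eps0 [n0 C_small]].
pose q := fine (pi C); have qE : pi C = q%:E by rewrite fineK ?fin_num_measure.
have q0 : (0 < q)%R by rewrite -lte_fin -qE.
exists (eps * eps * q / 4)%R; first by rewrite divr_gt0// !mulr_gt0.
exists (n0 + n0)%N => x A Cx mA.
have mAC : measurable (C `&` A) by exact: measurableI.
have nAC := nnmeas_ind R mAC; have nA := nnmeas_ind R mA.
pose U := kernel_op P.
have pos_iter n : positive_op (iter n U).
  exact: positive_op_iter (positive_kernel_op P).
pose g := iter n0 U (ind (C `&` A)).
have ng : nnmeas g by exact: (pos_iter n0).1.
pose p := fine (pi (C `&` A)).
have pE : pi (C `&` A) = p%:E by rewrite fineK ?fin_num_measure.
have p0 : (0 <= p)%R by rewrite -lee_fin -pE.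
have dpi := daniell_integral pi measurableT.
have dnu := daniell_integral nu measurableT.
have g_mass E : measurable E ->
    eps%:E * nu E * p%:E <= \int[pi]_y (ind E y * g y).
  move=> mE; have nE := nnmeas_ind R mE.
  rewrite reversible_integral_iter// -pE -(integral_ind pi mAC).
  have e0 : 0 <= eps%:E * nu E by rewrite mule_ge0// lee_fin ltW.
  rewrite -(integral_scale pi e0 nAC).
  apply: (daniell_mono dpi).
  - by apply: nnmeasM => //; exact: nnmeas_cst.
  - by apply: nnmeasM => //; exact: (pos_iter n0).1.
  - move=> y; have [[Cy Ay]|ACy] := pselect ((C `&` A) y).
      by rewrite ind_in// mule1 mul1e -kernel_iterE C_small.
    by rewrite ind_notin// mule0 mul0e.
have g_int : (eps * p / 4)%:E <= \int[nu]_y g y.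
  have [p00|pN0] := eqVneq p 0%R.
    by rewrite p00 mulr0 mul0r integral_ge0// => y _; exact: ng.2.
  have pp : (0 < p)%R by rewrite lt_neqAle eq_sym pN0.
  pose t := (eps * p / 2)%R.
  have t0 : (0 < t)%R by rewrite divr_gt0// mulr_gt0.
  pose S := [set y | g y < t%:E].
  have mS : measurable S.
    by have := emeasurable_fun_infty_o measurableT ng.1 t%:E; rewrite setTI.
  have nS : nu S <= (2^-1)%:E.
    have : eps%:E * nu S * p%:E <= t%:E.
      apply: le_trans (g_mass _ mS) _.
      apply: (@le_trans _ _ (\int[pi]_y t%:E)); last first.
        by rewrite integral_prob_cst.
      apply: (daniell_mono dpi).
      - by apply: nnmeasM => //; exact: nnmeas_ind.
      - by apply: nnmeas_cst; rewrite lee_fin ltW.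
      - move=> y; have [Sy|Sy] := pselect (S y).
          by rewrite ind_in// mul1e; exact: ltW.
        by rewrite ind_notin// mul0e lee_fin ltW.
    have -> : nu S = (fine (nu S))%:E by rewrite fineK ?fin_num_measure.
    rewrite -!EFinM !lee_fin /t => h.
    rewrite -(@ler_pM2l _ (eps * p)) ?mulr_gt0//.
    by apply: le_trans h; rewrite mulrAC.
  have nSc : (2^-1)%:E <= nu (~` S).
    rewrite probability_setC//.
    have nSE : nu S = (fine (nu S))%:E by rewrite fineK ?fin_num_measure.
    move: nS; rewrite nSE.
    by rewrite -EFinB !lee_fin; lra.
  apply: (@le_trans _ _ (\int[nu]_y (t%:E * ind (~` S) y))).
    rewrite integral_scale//; last 2 first.
    - by rewrite lee_fin ltW.
    - exact/nnmeas_ind/measurableC.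
    rewrite integral_ind; last exact: measurableC.
    apply: (@le_trans _ _ (t%:E * (2^-1)%:E)); last first.
      by apply: lee_wpmul2l => //; rewrite lee_fin ltW.
    by rewrite -EFinM lee_fin /t; lra.
  apply: (daniell_mono dnu) => //.
    apply: nnmeasM; first by apply: nnmeas_cst; rewrite lee_fin ltW.
    exact/nnmeas_ind/measurableC.
  move=> y; have [Sy|Sy] := pselect (S y).
    by rewrite ind_notin ?mule0 => [|/(_ Sy)//]; exact: ng.2.
  by rewrite ind_in// mule1 leNgt; apply/negP.
rewrite muE// kernel_iterE iterD.
apply: (@le_trans _ _ (iter n0 U g x)); last first.
  rewrite /g -!iterD; apply: (daniell_mono ((pos_iter _).2 x)) => // y.
  by rewrite -ind_mulI; apply: ind_mul_le; exact: nA.2.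
apply: le_trans (small_integral eps0 C_small ng Cx).
apply: (@le_trans _ _ (eps%:E * (eps * p / 4)%:E)); last first.
  by apply: lee_wpmul2l => //; rewrite lee_fin ltW.
rewrite /normalized_restriction setIC -/p -/q -!EFinM lee_fin.
rewrite [leLHS](_ : _ = eps * (eps * p / 4))%R//.
by field; rewrite gt_eqF.
Qed.

End reversible_small_sets.

(** * The chain killed on entering a set *)

Section killed_kernel.
Context d (T : measurableType d) (R : realType).
Implicit Types (f g : T -> \bar R) (A B : set T).
Variables (P : R.-pker T ~> T) (B : set T).
Hypothesis mB : measurable B.

Definition killed_op f := kernel_op P (fun y => ind (~` B) y * f y).

Lemma positive_killed_op : positive_op killed_op.
Proof.
apply: positive_op_comp (positive_kernel_op P) (positive_op_mul _).
exact/nnmeas_ind/measurableC.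
Qed.

Lemma nnmeas_iter_killed_op n f : nnmeas f -> nnmeas (iter n killed_op f).
Proof. exact: (positive_op_iter n positive_killed_op).1. Qed.

Lemma killed_op_le f x : nnmeas f -> killed_op f x <= kernel_op P f x.
Proof.
move=> nf; apply: (daniell_mono ((positive_kernel_op P).2 x)) => //.
  by apply: nnmeasM => //; exact/nnmeas_ind/measurableC.
by move=> y; apply: ind_mul_le; exact: nf.2.
Qed.

Lemma iter_killed_op_le n f x : nnmeas f ->
  iter n killed_op f x <= iter n (kernel_op P) f x.
Proof.
move=> nf; elim: n x => [//|n IH] x /=.
have nn := nnmeas_iter_killed_op n nf.
apply: le_trans (killed_op_le x nn) _.
apply: (daniell_mono ((positive_kernel_op P).2 x)) => //.
exact: nnmeas_iter_kernel_op.
Qed.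

(** [survival_sum N x] is the expectation, for the chain started at [x], of the
    minimum of [N] and the first positive time at which the chain is in [B]. *)
Definition survival_sum N x := \sum_(j < N) iter j killed_op (fun=> 1) x.

Lemma nnmeas_survival_sum N : nnmeas (survival_sum N).
Proof.
by apply: nnmeas_sum => j; apply: nnmeas_iter_killed_op; exact: nnmeas_cst.
Qed.

Lemma survival_sum_le N x : survival_sum N x <= N%:R%:E.
Proof.
rewrite /survival_sum; apply: (@le_trans _ _ (\sum_(j < N) 1)).
  apply: lee_sum => j _; rewrite -[leRHS](iter_kernel_op_cst P j 1 x).
  by apply: iter_killed_op_le; exact: nnmeas_cst.
by rewrite sumEFin lee_fin sumr_const card_ord.
Qed.

Lemma survival_sumS N x :
  survival_sum N.+1 x = 1 + killed_op (survival_sum N) x.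
Proof.
rewrite /survival_sum big_ord_recl /=; congr (_ + _).
rewrite (daniell_sum _ (positive_killed_op.2 x))// => j.
by apply: nnmeas_iter_killed_op; exact: nnmeas_cst.
Qed.

Lemma survival_sum_nd N x : survival_sum N x <= survival_sum N.+1 x.
Proof.
rewrite /survival_sum big_ord_recr /= leeDl//.
by apply: (nnmeas_iter_killed_op N _).2; exact: nnmeas_cst.
Qed.

Lemma survival_sum_step N x :
  survival_sum N x <= 1 + killed_op (survival_sum N) x.
Proof. by rewrite -survival_sumS survival_sum_nd. Qed.

(** Waiting [j] steps shortens the time until the next visit by at most [j]. *)
Lemma survival_sum_iter N j x :
  survival_sum N x <= j%:R%:E + iter j (kernel_op P) (survival_sum N) x.
Proof.
have nS := nnmeas_survival_sum N.
elim: j x => [|j IH] x; first by rewrite add0e.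
apply: le_trans (survival_sum_step N x) _.
rewrite -nat1r EFinD -addeA; apply: leeD2l.
apply: le_trans (killed_op_le x nS) _.
have nc : nnmeas (fun _ : T => j%:R%:E : \bar R).
  by apply: nnmeas_cst; rewrite lee_fin.
have nI := nnmeas_iter_kernel_op P j nS.
apply: (le_trans (daniell_mono ((positive_kernel_op P).2 x) nS
  (nnmeasD nc nI) IH)).
rewrite (daniellD ((positive_kernel_op P).2 x))//.
by rewrite kernel_op_cst.
Qed.

Section stationary.
Variable pi : probability T R.
Hypothesis stat : stationary P pi.

Let dpi := daniell_integral pi measurableT.

(** A form of Kac's formula for the mean return time to [B]. Under [pi] the
    mean survival time [F] has the same integral as its image by [P]; since
    [F <= 1 + P (1_{~B} F)], the part of that integral carried by [B] is at
    most 1. For [j] steps, [pi(P^j F) = pi(F)] is split over [B] and its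
    complement, and on the complement [P^j F >= F - j]. The truncation at [N]
    keeps every term finite, so that subtracting is legitimate. *)
Lemma kac_bound N j :
  \int[pi]_x (ind B x * iter j (kernel_op P) (survival_sum N) x) <= j.+1%:R%:E.
Proof.
set F := survival_sum N; have nF : nnmeas F := nnmeas_survival_sum N.
set G := iter j (kernel_op P) F.
have nG : nnmeas G by exact: nnmeas_iter_kernel_op.
have nB := nnmeas_ind R mB; have nB' := nnmeas_ind R (measurableC mB).
have F_N x : F x <= N%:R%:E := survival_sum_le N x.
have split_int h : nnmeas h -> \int[pi]_x h x =
    \int[pi]_x (ind B x * h x) + \int[pi]_x (ind (~` B) x * h x).
  move=> nh; rewrite -(daniellD dpi) => [|//|//]; last first.
  - exact: nnmeasM.
  - exact: nnmeasM.
  - by apply: eq_integral => x _; exact: ind_add_setC.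
have fin h : nnmeas h -> (forall x, h x <= N%:R%:E) ->
    exists2 s : R, (0 <= s)%R & \int[pi]_x h x = s%:E.
  move=> nh hN; apply: (@bounded_ge0_fin _ _ N%:R).
    exact: (daniell_ge0 dpi).
  apply: le_trans (daniell_mono dpi nh _ hN) _.
    by apply: nnmeas_cst; rewrite lee_fin.
  by rewrite integral_prob_cst.
have finM A h : measurable A -> nnmeas h -> (forall x, h x <= N%:R%:E) ->
    exists2 s : R, (0 <= s)%R & \int[pi]_x (ind A x * h x) = s%:E.
  move=> mA nh hN; apply: fin => [|x].
    by apply: nnmeasM => //; exact: nnmeas_ind.
  by apply: le_trans (hN x); apply: ind_mul_le; exact: nh.2.
have G_N x : G x <= N%:R%:E.
  rewrite -[leRHS](iter_kernel_op_cst P j _ x).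
  exact: iter_kernel_op_mono.
have [a a0 aE] := fin _ nF F_N.
have [aB _ aBE] := finM _ _ mB nF F_N.
have [aI _ aIE] := finM _ _ (measurableC mB) nF F_N.
have [bB _ bBE] := finM _ _ mB nG G_N.
have [bI _ bIE] := finM _ _ (measurableC mB) nG G_N.
have splitF : (a = aB + aI)%R.
  by apply/EFin_inj; rewrite EFinD -aE -aBE -aIE -split_int.
have splitG : (a = bB + bI)%R.
  apply/EFin_inj; rewrite EFinD -aE -bBE -bIE -split_int//.
  by rewrite stationary_integral.
have kac : (a <= 1 + aI)%R.
  rewrite -lee_fin EFinD -aE -aIE.
  have nIF : nnmeas (fun x => ind (~` B) x * F x) by exact: nnmeasM.
  rewrite -(stationary_integral stat 1 nIF) /=.
  rewrite -[1%:E](integral_prob_cst pi).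
  rewrite -(daniellD dpi) => [|//|]; last exact: (positive_kernel_op P).1.
  apply: (daniell_mono dpi) => //.
    by apply: nnmeasD => //; exact: (positive_kernel_op P).1.
  exact: survival_sum_step.
have step : (aI <= j%:R + bI)%R.
  rewrite -lee_fin EFinD -aIE -bIE.
  apply: (@le_trans _ _ (\int[pi]_x (j%:R%:E + ind (~` B) x * G x))).
    apply: (daniell_mono dpi); first exact: nnmeasM.
      apply: nnmeasD; first by apply: nnmeas_cst; rewrite lee_fin.
      exact: nnmeasM.
    move=> x; have [Bx|Bx] := pselect ((~` B) x).
      by rewrite ind_in// !mul1e; exact: survival_sum_iter.
    by rewrite ind_notin// !mul0e adde0 lee_fin.
  rewrite (daniellD dpi) => [||]; last 2 first.
  - by apply: nnmeas_cst; rewrite lee_fin.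
  - exact: nnmeasM.
  by rewrite leeD2r// integral_prob_cst.
by rewrite bBE lee_fin -natr1; lra.
Qed.

End stationary.

End killed_kernel.

(** * Mean hitting times under a small measure *)

Section convergence_to_stationarity.
Context d (T : measurableType d) (R : realType).
Variables (P : R.-pker T ~> T) (pi : probability T R).

Lemma harris_ergodic_cvg x A : harris_ergodic P pi -> measurable A ->
  kernel_iter P n x A @[n --> \oo] --> pi A.
Proof.
move=> [_ /(_ x) tv_cvg] mA.
apply/(sube_cvg0 _ (fin_num_measure pi A mA))/cvg_abse0P.
apply: (@squeeze_cvge _ _ _ _ (fun=> 0)) tv_cvg; last exact: cvg_cst.
apply: nearW => n; rewrite abse_ge0 /=.
by apply: ereal_sup_ubound; exists A.
Qed.

Lemma ergodic_visit B C : harris_ergodic P pi -> measurable B -> measurable C ->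
  0 < pi B -> 0 < pi C ->
  exists n, 0 < \int[pi]_x (ind B x * iter n (kernel_op P) (ind C) x).
Proof.
move=> erg mB mC piB piC.
have nB := nnmeas_ind R mB; have nC := nnmeas_ind R mC.
have nI n := nnmeas_iter_kernel_op P n nC.
have I1 n x : iter n (kernel_op P) (ind C) x <= 1.
  rewrite -[leRHS](iter_kernel_op_cst P n _ x).
  by apply: iter_kernel_op_mono => // y; exact: ind_le1.
have : \int[pi]_x (ind B x * iter n (kernel_op P) (ind C) x) @[n --> \oo] -->
    \int[pi]_x (ind B x * pi C).
  apply: (@dominated_cvg _ _ _ pi _ measurableT _ _ (fun=> 1)) => //.
  - by move=> n; exact: (nnmeasM nB (nI n)).1.
  - move=> x _; apply: cvgeZl => //.
    under eq_fun do rewrite -kernel_iterE.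
    exact: harris_ergodic_cvg.
  - exact: finite_measure_integrable_cst.
  - move=> n x _; rewrite gee0_abs; last exact: (nnmeasM nB (nI n)).2.
    by apply: le_trans (I1 n x); apply: ind_mul_le; exact: (nI n).2.
under eq_integral do rewrite muleC.
rewrite integral_scale// integral_ind// => visit_cvg.
apply: contrapT => /forallNP visit0.
have : 0 < pi C * pi B by exact: mule_gt0.
rewrite -(cvg_lim _ visit_cvg)//.
rewrite (_ : (fun n => _) = fun=> 0) ?lim_cst ?ltxx//.
apply/funext => n; apply/le_anti/andP; split.
  by rewrite leNgt; apply/negP; exact: visit0.
by apply: integral_ge0 => x _; exact: (nnmeasM nB (nI n)).2.
Qed.

End convergence_to_stationarity.

Section mean_hitting_time.
Context d (T : measurableType d) (R : realType).
Variables (P : R.-pker T ~> T) (pi nu : probability T R).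

(** Started from a small measure, the chain reaches [B] in finite mean time.
    By [ergodic_visit] there is an [i] such that, from [pi] restricted to [B],
    the chain is in [C] after [i] steps with probability [v > 0], and [n0]
    steps later it is distributed at least as [eps nu]. The mean survival time
    [F] under [nu] thus satisfies
    [eps v \int F dnu <= \int_B P^(i + n0) F dpi], which [kac_bound]
    controls. *)
Lemma small_measure_hitting B C : harris_ergodic P pi ->
  measurable B -> measurable C -> 0 < pi B -> 0 < pi C -> small_with P C nu ->
  exists c : R, forall N,
    \sum_(j < N) \int[nu]_x iter j (killed_op P B) (fun=> 1) x <= c%:E.
Proof.
move=> erg mB mC piB piC [eps eps0 [n0 C_small]].
have [i visit] := ergodic_visit erg mB mC piB piC.
have nB := nnmeas_ind R mB; have nC := nnmeas_ind R mC.
have nI := nnmeas_iter_kernel_op P i nC.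
have dpi := daniell_integral pi measurableT.
have dnu := daniell_integral nu measurableT.
have [v v0 vE] : exists2 v : R, (0 < v)%R &
    \int[pi]_x (ind B x * iter i (kernel_op P) (ind C) x) = v%:E.
  have [] := @bounded_ge0_fin _
    (\int[pi]_x (ind B x * iter i (kernel_op P) (ind C) x)) 1.
  - exact: ltW.
  - rewrite -[leRHS](integral_prob_cst pi).
    apply: (daniell_mono dpi) => [||x]; [exact: nnmeasM|exact: nnmeas_cst|].
    apply: le_trans (ind_mul_le _ (nI.2 x)) _.
    rewrite -[leRHS](iter_kernel_op_cst P i _ x).
    by apply: iter_kernel_op_mono => // y; exact: ind_le1.
  - by move=> v _ vE; exists v => //; rewrite -lte_fin -vE.
exists ((i + n0).+1%:R / (eps * v))%R => N.
have nQ j : nnmeas (iter j (killed_op P B) (fun=> 1)).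
  by apply: nnmeas_iter_killed_op.
rewrite -(daniell_sum _ dnu)//.
set F := survival_sum P B N; have nF : nnmeas F := nnmeas_survival_sum P mB N.
rewrite -[X in X <= _]/(\int[nu]_x F x).
have [m m0 mE] : exists2 m : R, (0 <= m)%R & \int[nu]_x F x = m%:E.
  apply: (@bounded_ge0_fin _ _ N%:R); first exact: (daniell_ge0 dnu).
  apply: le_trans (daniell_mono dnu nF _ (survival_sum_le P mB N)) _ => //.
  by rewrite integral_prob_cst.
rewrite mE lee_fin ler_pdivlMr ?mulr_gt0// -lee_fin.
apply: le_trans (kac_bound mB erg.1 N (i + n0)).
rewrite mulrA (mulrC m) EFinM -vE -integral_scale; last 2 first.
- by rewrite lee_fin mulr_ge0// ltW.
- exact: nnmeasM.
have e0 : 0 <= (eps * m)%:E by rewrite lee_fin mulr_ge0// ltW.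
apply: (daniell_mono dpi).
- by apply: nnmeasM; [exact: nnmeas_cst|exact: nnmeasM].
- by apply: nnmeasM => //; exact: nnmeas_iter_kernel_op.
move=> x; rewrite muleCA; apply: lee_wpmul2l; first exact: nB.2.
have nG := nnmeas_iter_kernel_op P n0 nF.
rewrite iterD.
have pos_iter := positive_op_iter i (positive_kernel_op P).
rewrite -(daniellZ (pos_iter.2 x))//.
apply: iter_kernel_op_mono => //; first exact: nnmeasM.
move=> y; have [Cy|Cy] := pselect (C y).
  rewrite ind_in// mule1 EFinM -mE.
  by move: (small_integral eps0 C_small nF Cy).
by rewrite ind_notin// mule0; exact: nG.2.
Qed.

End mean_hitting_time.

(** * Borel sets of a metric space *)

Section borel_sets_of_a_metric_space.
Context (R : realType) (T : pmetricType R).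
Implicit Types (K : set T) (r : R).

Lemma measurable_open (A : set T) : open A -> measurable (A : set (borel T)).
Proof. by move=> oA; exact: sub_sigma_algebra. Qed.

Lemma open_lipschitz_gt (f : T -> R) r :
  (forall x y, f x <= mdist x y + f y)%R -> open [set x | (r < f x)%R].
Proof.
move=> f_lip; rewrite openE => x /= rfx; apply/nbhs_ballP.
exists (f x - r)%R => /=; first by rewrite subr_gt0.
by move=> y; rewrite ballEmdist /= => xy; have := f_lip x y; lra.
Qed.

Lemma measurable_far (o : T) r :
  measurable ([set x | (r < mdist x o)%R] : set (borel T)).
Proof.
apply: measurable_open; apply: open_lipschitz_gt => x y.
exact: metric_triangle.
Qed.

Lemma inf_dist_le K x y : K y ->
  (inf [set mdist x z | z in K] <= mdist x y)%R.
Proof.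
move=> Ky; apply: ge_inf; last by exists y.
by exists 0%R => _ [z _ <-]; exact: mdist_ge0.
Qed.

Lemma inf_dist_lipschitz K x y : K !=set0 ->
  (inf [set mdist x z | z in K] <= mdist x y + inf [set mdist y z | z in K])%R.
Proof.
move=> [z0 Kz0]; rewrite -lerBlDl; apply: lb_le_inf.
  by exists (mdist y z0), z0.
move=> _ [z Kz <-]; rewrite lerBlDl.
by apply: le_trans (metric_triangle _ _ _); exact: inf_dist_le.
Qed.

(** The distance to [K] is 1-Lipschitz, so thickenings are closed. *)
Lemma measurable_thickening K r : K !=set0 ->
  measurable (thickening K r : set (borel T)).
Proof.
move=> K0; rewrite -[X in measurable X]setCK; apply: measurableC.
rewrite (_ : ~` _ = [set x | (r < inf [set mdist x y | y in K])%R]).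
  apply: measurable_open; apply: open_lipschitz_gt => x y.
  exact: inf_dist_lipschitz.
by apply/seteqP; split => x /= => [/negP|]; rewrite ltNge // => /negP.
Qed.

Lemma sub_thickening K r : (0 <= r)%R -> K `<=` thickening K r.
Proof.
move=> r0 x Kx; apply: le_trans r0; rewrite -(mdistxx x); exact: inf_dist_le.
Qed.

Lemma thickening_step K r s x y : K !=set0 -> thickening K r x ->
  (mdist x y <= s)%R -> thickening K (r + s) y.
Proof.
rewrite /thickening /= => K0 Kx xy; have := inf_dist_lipschitz y x K0.
by rewrite metric_sym; lra.
Qed.

Lemma metric_bounded_thickening K r (o : T) : K !=set0 -> metric_bounded K ->
  exists L : R, forall x, thickening K r x -> (mdist x o <= L)%R.
Proof.
move=> [z0 Kz0] [b Kb]; exists (r + 1 + b + mdist z0 o)%R => x Kx.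
have [|_ [y Ky <-]] := @inf_adherent _ [set mdist x y | y in K] 1%R ltr01.
  split; first by exists (mdist x z0), z0.
  by exists 0%R => _ [z _ <-]; exact: mdist_ge0.
move=> xy; have := metric_triangle x y o; have := metric_triangle y z0 o.
by move: (Kb _ _ Ky Kz0) Kx; rewrite /thickening /=; lra.
Qed.

Lemma far_measure_cvg0 (m : probability (borel T) R) (o : T) :
  m [set x | (n%:R < mdist x o)%R] @[n --> \oo] --> 0.
Proof.
pose F (n : nat) : set (borel T) := [set x | (n%:R < mdist (x : T) o)%R].
have mF n : measurable (F n) by exact: measurable_far.
have cap0 : \bigcap_n F n = set0.
  rewrite -subset0 => x Fx; have := Fx (Num.bound (mdist (x : T) o)) Logic.I.
  rewrite /F /= ltNge => /negP; apply.
  by apply/ltW/archi_boundP; exact: mdist_ge0.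
have := @nonincreasing_cvg_mu _ _ _ m F; rewrite cap0 measure0; apply => //.
  by apply: le_lt_trans (probability_le1 m (mF 0%N)) _; rewrite ltry.
move=> i j ij; apply/subsetPset => x; rewrite /F /=; apply: le_lt_trans.
by rewrite ler_nat.
Qed.

End borel_sets_of_a_metric_space.

(** * The Markov property off [K] *)

Section random_variables.
Context d (Omega : measurableType d) (R : realType).

Lemma daniell_comp d' (T : measurableType d')
    (Psi : (Omega -> \bar R) -> \bar R) (phi : Omega -> T) :
  measurable_fun setT phi -> daniell Psi ->
  daniell (fun g : T -> \bar R => Psi (g \o phi)).
Proof.
move=> mphi dPsi.
have nphi (g : T -> \bar R) : nnmeas g -> nnmeas (g \o phi).
  by move=> [mg g0]; split=> [|w] /=; [exact: measurableT_comp|exact: g0].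
split=> [f g nf ng fg|f g nf ng|a f a0 nf|f nf ndf].
- apply: (daniell_mono dPsi); [exact: nphi|exact: nphi|] => w.
  exact: fg.
- exact (daniellD dPsi (nphi _ nf) (nphi _ ng)).
- exact (daniellZ dPsi a0 (nphi _ nf)).
- apply: (daniell_cvg dPsi (f := fun n => f n \o phi)) => [n|w].
    exact: nphi.
  exact: ndf.
Qed.

Lemma integral_setI_ind (m : {measure set Omega -> \bar R}) H E f :
  \int[m]_(w in H `&` E) f w = \int[m]_(w in H) (ind E w * f w).
Proof. by rewrite integral_mkcondr -ind_mul_patch. Qed.

Lemma ind_preimage T (X : Omega -> T) (A : set T) w :
  ind (X @^-1` A) w = (\1_A (X w))%:E :> \bar R.
Proof. by rewrite /ind /indic; congr (_%:R%:E); rewrite !mem_setE. Qed.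

Lemma measure_preimageI d' (T : measurableType d')
    (m : {measure set Omega -> \bar R}) (X : Omega -> T) E A :
  measurable E -> measurable_fun setT X -> measurable A ->
  m (E `&` X @^-1` A) = \int[m]_(w in E) ind A (X w).
Proof.
move=> mE mX mA.
have mXA : measurable (X @^-1` A) by rewrite -[_ @^-1` _]setTI; exact: mX.
rewrite -integral_ind; last exact: measurableI.
rewrite [RHS]integral_mkcond -ind_mul_patch.
by apply: eq_integral => w _; rewrite -ind_mulI ind_preimage.
Qed.

End random_variables.

Section adversarial_excursions.
Context (R : realType) (T : pmetricType R) (P : R.-pker (borel T) ~> (borel T)).
Context d (Omega : measurableType d) (Pr : probability Omega R).
Variables (D : R) (K : set T) (x0 : T) (X : nat -> {RV Pr >-> borel T}).
Hypothesis X_adv : adversarial_chain P D K x0 X.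

Lemma history_preimage i n (A : set (borel T)) : (i <= n)%N -> measurable A ->
  history X n (X i @^-1` A).
Proof.
move=> le_in mA; apply: sub_sigma_algebra.
have lt_in : (i < n.+1)%N by [].
rewrite (bigD1 (Ordinal lt_in))//=; left.
by exists A => //; rewrite setTI.
Qed.

Lemma historyI n E F : history X n E -> history X n F -> history X n (E `&` F).
Proof. exact: (@measurableI _ (g_sigma_algebraType _)). Qed.

Lemma history_measurable n E : history X n E -> measurable E.
Proof.
apply: smallest_sub; first exact: sigma_algebra_measurable.
apply: (big_ind (fun S => S `<=` measurable)) => [//|S S' mS mS' F []|i _ F].
- exact: mS.
- exact: mS'.
- by move=> [A mA <-]; rewrite setTI -[_ @^-1` _]setTI; exact: measurable_funP.
Qed.

(** Off [K] the conditional law of the next state is the kernel; being an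
    equality of integrals of indicators, it extends to all test functions. *)
Lemma markov_step n H (g : borel T -> \bar R) : history X n H ->
  H `<=` [set w | ~ K (X n w)] -> nnmeas g ->
  \int[Pr]_(w in H) g (X n.+1 w) = \int[Pr]_(w in H) kernel_op P g (X n w).
Proof.
move=> hH HK ng; have mH := history_measurable hH.
have mX i : measurable_fun setT (X i) by exact: measurable_funP.
have dH := daniell_integral Pr mH.
apply: (daniell_eq (daniell_comp (mX n.+1) dH)
  (daniell_op (daniell_comp (mX n) dH) (positive_kernel_op P))) ng => A mA /=.
have [f [_ f_int f_cond] fE] := adv_outside X_adv n mA.
transitivity (\int[Pr]_(w in H) (f w)%:E).
  rewrite f_cond//; under eq_integral do rewrite /ind -ind_preimage.
  rewrite integral_indic// -[_ @^-1` _]setTI; exact: mX.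
apply: ae_eq_integral => //.
- exact: measurable_funTS (measurable_int _ f_int).
- apply: measurable_funTS; apply: measurableT_comp (mX n).
  exact: ((positive_kernel_op P).1 _ (nnmeas_ind R mA)).1.
- apply: filterS fE => w fE Hw; rewrite fE ?kernel_op_ind//.
  exact: HK.
Qed.

End adversarial_excursions.

(** * Excursions out of [B] through [C] *)

Section excursions.
Context (R : realType) (T : pmetricType R) (P : R.-pker (borel T) ~> (borel T)).
Context d (Omega : measurableType d) (Pr : probability Omega R).
Variables (D : R) (K : set T) (x0 : T) (X : nat -> {RV Pr >-> borel T}).
Hypothesis X_adv : adversarial_chain P D K x0 X.
Hypothesis K_meas : measurable (K : set (borel T)).
Variables B C : set (borel T).
Hypotheses (mB : measurable B) (mC : measurable C).
Hypotheses (KB : K `<=` B) (CB : C `<=` ~` B).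

(** Times are written [j.+1 + k], in this order, so that one more step is a
    successor by computation. *)
Fixpoint excursion (k j : nat) : set Omega :=
  if j is i.+1 then excursion k i `&` (X (i.+2 + k) @^-1` (~` B))
  else (X k @^-1` (B `\` K)) `&` (X k.+1 @^-1` C).

Lemma history_excursion k j n : (j.+1 + k <= n)%N ->
  history X n (excursion k j).
Proof.
elim: j => [|j IH] /= le_n.
  apply: historyI; apply: history_preimage => //; first exact: ltnW.
  exact: measurableD.
apply: historyI; first by apply: IH; exact: ltnW.
by apply: history_preimage => //; exact: measurableC.
Qed.

Lemma measurable_excursion k j : measurable (excursion k j).
Proof. exact: history_measurable (history_excursion (leqnn _)). Qed.

Lemma excursion_out k j i w : excursion k j w -> (k < i <= j.+1 + k)%N ->
  ~ B (X i w).
Proof.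
elim: j => [|j IH] /= [].
  move=> _ Cw /andP[ki ik]; have -> : i = k.+1 by apply/eqP; rewrite eqn_leq ik.
  exact: CB.
move=> exc Bw /andP[ki]; rewrite leq_eqVlt => /orP[/eqP->//|ij].
by apply: IH => //; rewrite ki.
Qed.

Lemma excursion_in k j w : excursion k j w -> B (X k w).
Proof. by elim: j => [|j IH] /= [] => [[]|/IH]. Qed.

Let excursion_off_K k j : excursion k j `<=` [set w | ~ K (X (j.+1 + k) w)].
Proof.
move=> w exc /KB; apply: (excursion_out exc).
by rewrite leqnn andbT addSn ltnS leq_addl.
Qed.

Lemma excursion_step k j (g : borel T -> \bar R) : nnmeas g ->
  \int[Pr]_(w in excursion k j) g (X (j.+2 + k)%N w) =
  \int[Pr]_(w in excursion k j) kernel_op P g (X (j.+1 + k)%N w).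
Proof.
move=> ng; apply: (markov_step X_adv) ng; last exact: excursion_off_K.
exact: history_excursion.
Qed.

Variables (mu : probability (borel T) R) (M : R).
Hypothesis M_ge0 : (0 <= M)%R.
Hypothesis P_le_mu : forall x A, (B `\` K) x -> measurable A -> A `<=` C ->
  P x A <= M%:E * mu A.

Lemma kernel_op_le_mu x (g : borel T -> \bar R) : (B `\` K) x -> nnmeas g ->
  kernel_op P (fun y => ind C y * g y) x <= M%:E * \int[mu]_y g y.
Proof.
move=> BKx; have nC := nnmeas_ind R mC.
have pos : positive_op (kernel_op P \o fun g y => ind C y * g y).
  exact: positive_op_comp (positive_kernel_op P) (positive_op_mul nC).
apply: (daniell_le (pos.2 x)
  (daniell_scale M_ge0 (daniell_integral mu measurableT))) => A mA /=.
under eq_fun do rewrite ind_mulI.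
have mCA : measurable (C `&` A) by exact: measurableI.
rewrite kernel_op_ind// integral_ind//.
apply: (@le_trans _ _ (M%:E * mu (C `&` A))).
  by apply: P_le_mu => // y [].
apply: lee_wpmul2l; first by rewrite lee_fin.
by apply: le_measure => [||y []//]; exact: mem_set.
Qed.

(** The state during an excursion is distributed at most as [M] times the chain
    started from [mu] and killed on entering [B]: the jump to [C] has law at
    most [M mu], and from then on the chain is off [K], where it follows
    [P]. The bound does not depend on [k]. *)
Lemma excursion_le k j (g : borel T -> \bar R) : nnmeas g ->
  \int[Pr]_(w in excursion k j) g (X (j.+1 + k)%N w) <=
  M%:E * \int[mu]_y iter j (killed_op P B) g y.
Proof.
elim: j g => [|j IH] g ng.
  have mX i : measurable_fun setT (X i) by exact: measurable_funP.
  have mBK : measurable (B `\` K) by exact: measurableD.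
  pose H := X k @^-1` (B `\` K).
  have hH : history X k H by exact: history_preimage.
  have nCg : nnmeas (fun y => ind C y * g y).
    by apply: nnmeasM => //; exact: nnmeas_ind.
  rewrite /= integral_setI_ind; under eq_integral do rewrite ind_preimage.
  rewrite (markov_step X_adv hH _ nCg) => [|w []//].
  have mu0 : 0 <= M%:E * \int[mu]_y g y.
    by rewrite mule_ge0 ?lee_fin// integral_ge0// => y _; exact: ng.2.
  apply: (@le_trans _ _ (\int[Pr]_(w in H) (M%:E * \int[mu]_y g y))).
    apply: ge0_le_integral => //.
    - exact: history_measurable hH.
    - by move=> w _; exact: ((positive_kernel_op P).1 _ nCg).2.
    - apply: measurable_funTS; apply: measurableT_comp (mX k).
      exact: ((positive_kernel_op P).1 _ nCg).1.
    - by move=> w BKw; exact: kernel_op_le_mu.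
  rewrite integral_cst; last exact: history_measurable hH.
  rewrite -[leRHS]mule1; apply: lee_wpmul2l => //.
  by apply: probability_le1; exact: history_measurable hH.
have nBg : nnmeas (fun y => ind (~` B) y * g y).
  by apply: nnmeasM => //; exact/nnmeas_ind/measurableC.
rewrite [X in \int[_]_(_ in X) _]/= integral_setI_ind.
under eq_integral do rewrite ind_preimage.
rewrite (excursion_step _ _ nBg) iterSr.
by apply: IH; exact: (positive_killed_op P mB).1.
Qed.

Lemma excursion_mass_le k j A : measurable A ->
  Pr (excursion k j `&` X (j.+1 + k)%N @^-1` A) <=
  M%:E * \int[mu]_y iter j (killed_op P B) (ind A) y.
Proof.
move=> mA; rewrite measure_preimageI//; last exact: measurable_excursion.
exact: excursion_le (nnmeas_ind R mA).
Qed.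

Lemma excursion_return_le k j :
  Pr (excursion k j `&` X (j.+2 + k)%N @^-1` B) <=
  M%:E * \int[mu]_y iter j.+1 (kernel_op P) (ind B) y.
Proof.
have nB := nnmeas_ind R mB.
have nUB : nnmeas (kernel_op P (ind B)) by exact: (positive_kernel_op P).1.
rewrite measure_preimageI//; last exact: measurable_excursion.
rewrite excursion_step//; apply: le_trans (excursion_le k j nUB) _.
apply: lee_wpmul2l; first by rewrite lee_fin.
rewrite iterSr; apply: (daniell_mono (daniell_integral mu measurableT)).
- exact: nnmeas_iter_killed_op.
- exact: nnmeas_iter_kernel_op.
- by move=> y; exact: iter_killed_op_le.
Qed.

Lemma excursion_never_returns k j :
  (forall i, \int[mu]_y iter i (kernel_op P) (ind B) y = 0) ->
  Pr (excursion k j) = Pr (excursion k 0).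
Proof.
move=> never; elim: j => [//|j <-].
have mF : measurable (X (j.+2 + k)%N @^-1` B).
  by rewrite -[_ @^-1` _]setTI; exact: measurable_funP.
have mexc i : measurable (excursion k i) by exact: measurable_excursion.
apply/le_anti/andP; split.
  by apply: le_measure => [||w []//]; exact/mem_set.
have null : Pr (excursion k j `&` X (j.+2 + k)%N @^-1` B) = 0.
  apply/le_anti/andP; split; last exact: measure_ge0.
  by apply: le_trans (excursion_return_le k j) _; rewrite never mule0.
rewrite -[leRHS]adde0 -null.
apply: le_trans (measureU2 Pr (mexc j.+1) (measurableI _ _ (mexc j) mF)).
apply: le_measure => [||w exc]; [exact: mem_set|apply: mem_set|].
  by apply: measurableU => //; exact: measurableI.
by have [Bw|Bw] := pselect (B (X (j.+2 + k)%N w)); [right|left].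
Qed.

End excursions.

(** * Decomposition at the last visit to [B] *)

Section sums_with_small_tails.
Context (R : realType).
Implicit Types s t : nat -> \bar R.

Definition small_tails s := forall e : R, (0 < e)%R ->
  exists J, forall N, \sum_(J <= k < N) s k <= e%:E.

Lemma cvg0_small (u : nat -> \bar R) (e : R) : u n @[n --> \oo] --> 0 ->
  (0 < e)%R -> exists n, u n <= e%:E.
Proof.
move=> /fine_cvgP[u_fin /cvgrPdist_lt u_lt] /u_lt {}u_lt.
suff [n _ un] : \forall n \near \oo, u n <= e%:E.
  by exists n; exact: un (leqnn n).
near=> n; have fin : u n \is a fin_num by near: n.
have : (`|0 - fine (u n)| < e)%R by near: n.
rewrite sub0r normrN => lt_e; rewrite -(fineK fin) lee_fin.
exact: le_trans (ler_norm _) (ltW lt_e).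
Unshelve. all: by end_near. Qed.

Lemma bounded_sums_small_tails s (c : R) : (forall k, 0 <= s k) ->
  (forall N, \sum_(k < N) s k <= c%:E) -> small_tails s.
Proof.
move=> s0 s_le e e0.
have s_fin : \sum_(0 <= k <oo) s k < +oo.
  apply: (@le_lt_trans _ _ c%:E); last by rewrite ltry.
  apply: lime_le; first by apply: is_cvg_nneseries.
  by apply: nearW => N; rewrite big_mkord.
have [J sJ] := cvg0_small (nneseries_tail_cvg s_fin (fun k _ => s0 k)) e0.
exists J => N; apply: le_trans sJ.
exact: nneseries_lim_ge.
Qed.

(** Terms bounded both by [delta] and by a fixed summable sequence: the first
    bound serves for the [J] leading terms, the second for all the others. *)
Lemma sum_split_bound n s t (delta e : R) J : (0 <= delta)%R ->
  (forall k, (k < n)%N -> t k <= delta%:E) ->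
  (forall k, (k < n)%N -> t k <= s k) ->
  (forall N, \sum_(J <= k < N) s k <= e%:E) ->
  \sum_(k < n) t k <= (J%:R * delta + e)%:E.
Proof.
move=> delta0 t_delta t_s tail_e.
have e0 : (0 <= e)%R by have := tail_e 0%N; rewrite big_geq.
have head m : (m <= n)%N -> \sum_(k < m) t k <= (m%:R * delta)%:E.
  move=> mn; apply: (@le_trans _ _ (\sum_(k < m) delta%:E)).
    by apply: lee_sum => k _; apply: t_delta; exact: leq_trans mn.
  by rewrite sumEFin lee_fin sumr_const card_ord mulr_natl.
have [nJ|Jn] := leqP n J.
  apply: le_trans (head n (leqnn n)) _; rewrite lee_fin.
  by rewrite -[leLHS]addr0 lerD// ler_wpM2r// ler_nat.
rewrite -(big_mkord xpredT t) (big_cat_nat (leq0n J) (ltnW Jn))//= EFinD.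
apply: leeD; first by rewrite big_mkord; exact/head/ltnW.
apply: le_trans (tail_e n); rewrite big_nat [leRHS]big_nat.
by apply: lee_sum => k /andP[_ kn]; exact: t_s.
Qed.

End sums_with_small_tails.

Section last_exit_decomposition.
Context (R : realType) (T : pmetricType R) (P : R.-pker (borel T) ~> (borel T)).
Context d (Omega : measurableType d) (Pr : probability Omega R).
Variables (D : R) (K : set T) (x0 : T) (X : nat -> {RV Pr >-> borel T}).
Hypothesis X_adv : adversarial_chain P D K x0 X.
Hypothesis K_meas : measurable (K : set (borel T)).
Variables B C : set (borel T).
Hypotheses (mB : measurable B) (mC : measurable C).
Hypothesis CB : C `<=` ~` B.
Hypothesis B_x0 : B x0.
Hypothesis B_inside : thickening K D `<=` B.
Hypothesis B_exit : forall x, (B `\` K) x -> P x (~` (B `|` C)) = 0.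

Let exc := excursion K X B C.

Let mX i (A : set (borel T)) : measurable A -> measurable (X i @^-1` A).
Proof. by move=> mA; rewrite -[_ @^-1` _]setTI; exact: measurable_funP. Qed.

Let mexc k j : measurable (exc k j).
Proof. exact: measurable_excursion. Qed.

Lemma ae_exit n :
  {ae Pr, forall w, (B `\` K) (X n w) -> (B `|` C) (X n.+1 w)}.
Proof.
have mBK : measurable (B `\` K) by exact: measurableD.
have mBC : measurable (~` (B `|` C)) by apply/measurableC/measurableU.
pose H := X n @^-1` (B `\` K).
have hH : history X n H by exact: history_preimage.
exists (H `&` X n.+1 @^-1` (~` (B `|` C))); split.
- by apply: measurableI; exact: mX.
- rewrite measure_preimageI//; last exact: mX.
  rewrite (markov_step X_adv hH) => [|w []//|]; last exact: nnmeas_ind.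
  apply: integral0_eq => w BKw; rewrite kernel_op_ind//; exact: B_exit.
- by move=> w /not_implyP[].
Qed.

(** The chain starts in [B], can only leave it from [B `\` K], and then lands
    in [C]; so whenever it is out of [B] it is on the excursion that began at
    its last visit to [B]. *)
Lemma ae_last_exit n : {ae Pr, forall w, B (X n w) \/
  exists2 j, (j < n)%N & exc (n - j.+1) j w}.
Proof.
elim: n => [|n IH].
  by apply: filterS (adv_init X_adv) => w ->; left.
apply: filterS3 IH (ae_exit n) (adv_inside X_adv n) => w out exit inside.
have [Bw|Bw] := pselect (B (X n.+1 w)); [by left|right].
case: out => [Bn|[j jn excj]].
  have BKn : (B `\` K) (X n w) by split=> // /inside/B_inside.
  exists 0%N => //; rewrite subn1; split => //.
  by case: (exit BKn).
exists j.+1; first by rewrite ltnS.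
by rewrite subSS; split => //=; rewrite addSn subnKC.
Qed.

Lemma last_exit_sum n A : measurable A -> A `<=` ~` B ->
  Pr (X n @^-1` A) <= \sum_(j < n) Pr (exc (n - j.+1) j `&` X n @^-1` A).
Proof.
move=> mA AB; have [N [mN N0 outN]] := ae_last_exit n.
pose F j := exc (n - j.+1) j `&` X n @^-1` A.
have mF j : measurable (F j) by apply: measurableI; [exact: mexc|exact: mX].
have mU : measurable (\big[setU/set0]_(j < n) F j) by exact: bigsetU_measurable.
apply: (@le_trans _ _ (Pr (N `|` \big[setU/set0]_(j < n) F j))).
  apply: le_measure => [||w Aw]; [exact/mem_set/mX|exact/mem_set/measurableU|].
  have [Nw|Nw] := pselect (N w); [by left|right].
  have [/(AB _ Aw)//|[j jn excj]] := contrapT (fun h => Nw (outN w h)).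
  by rewrite -bigcup_mkord; exists j.
apply: (@le_trans _ _ (Pr (\big[setU/set0]_(j < n) F j))).
  by rewrite -[leRHS]add0e -N0; exact: measureU2.
by apply: Boole_inequality => j _; exact: mF.
Qed.

Lemma excursion_disjoint n k k' j j' w : (j.+1 + k = n)%N ->
  (j'.+1 + k' = n)%N -> exc k j w -> exc k' j' w -> k = k'.
Proof.
move=> <- jk' excj excj'; apply/eqP; rewrite eqn_leq; apply/andP.
have out a b a' b' : (b.+1 + a = b'.+1 + a')%N -> exc a b w -> exc a' b' w ->
    (a <= a')%N.
  move=> ab excb excb'; rewrite leqNgt; apply/negP => aa'.
  apply: (excursion_out CB excb' (i := a)); last exact: excursion_in excb.
  by rewrite aa' -ab leq_addl.
by split; [exact: out excj excj'|exact: out excj' excj].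
Qed.

(** At time [n] at most one excursion is under way. *)
Lemma excursion_sum_le1 n : \sum_(k < n) Pr (exc k (n - k.+1)) <= 1.
Proof.
rewrite -(@measure_bigsetU_ord _ _ _ Pr n xpredT (fun k => exc k (n - k.+1))).
- by apply: probability_le1; apply: bigsetU_measurable => k _; exact: mexc.
- by move=> k; exact: mexc.
- move=> k k' _ _ [w [exck exck']]; apply/val_inj.
  by apply: (excursion_disjoint (n := n) _ _ exck exck');
    rewrite addSn -addnS subnK.
Qed.

(** Up to [e], only [J] of the excursions possibly under way matter, with [J]
    independent of the time [n] and of the target [A]. *)
Definition tight_excursions := forall e : R, (0 < e)%R ->
  exists J : nat, forall (delta : R) A, (0 <= delta)%R ->
    measurable A -> A `<=` ~` B ->
    (forall k j, Pr (exc k j `&` X (j.+1 + k)%N @^-1` A) <= delta%:E) ->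
    forall n, Pr (X n @^-1` A) <= (J%:R * delta + e)%:E.

(** Long excursions contribute little when the bound [s j] on the probability
    that one lasts [j] more steps is summable; here the sum is split by the
    duration of the excursion. *)
Lemma tight_of_short_excursions s : small_tails s ->
  (forall k j, Pr (exc k j) <= s j) -> tight_excursions.
Proof.
move=> s_tail exc_s e e0; have [J sJ] := s_tail _ e0.
exists J => delta A delta0 mA AB exc_delta n.
apply: le_trans (last_exit_sum n mA AB) _.
apply: (sum_split_bound (s := s)
  (t := fun j => Pr (exc (n - j.+1) j `&` X n @^-1` A))) => // j jn.
  by have := exc_delta (n - j.+1)%N j; rewrite subnKC.
apply: le_trans (exc_s (n - j.+1)%N j).
apply: le_measure => [||w []//]; apply: mem_set; last exact: mexc.
by apply: measurableI; [exact: mexc|exact: mX].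
Qed.

(** When excursions never end, they are disjoint events, so their
    probabilities are summable over the starting time [k], and here the sum is
    split by that time. *)
Lemma tight_of_few_excursions :
  (forall k j, Pr (exc k j) = Pr (exc k 0)) -> tight_excursions.
Proof.
move=> exc_const e e0.
have few N : \sum_(k < N) Pr (exc k 0) <= 1%:E.
  apply: le_trans (excursion_sum_le1 N).
  by apply: lee_sum => k _; rewrite exc_const.
have [J sJ] := bounded_sums_small_tails
  (fun k => measure_ge0 Pr (exc k 0)) few e0.
exists J => delta A delta0 mA AB exc_delta n.
apply: le_trans (last_exit_sum n mA AB) _.
have nkK k : (k < n)%N -> (n - (n - k.+1).+1 = k)%N.
  by move=> kn; rewrite -subSn// subSS subKn// ltnW.
rewrite (reindex_inj rev_ord_inj) /=.
apply: (sum_split_bound (s := fun k => Pr (exc k 0))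
  (t := fun k => Pr (exc (n - (n - k.+1).+1) (n - k.+1) `&` X n @^-1` A)))
  => // k kn; rewrite nkK//.
  have := exc_delta k (n - k.+1)%N.
  by have -> : ((n - k.+1).+1 + k = n)%N by rewrite addSn -addnS subnK.
rewrite -(exc_const k (n - k.+1)%N).
apply: le_measure => [||w []//]; apply: mem_set; last exact: mexc.
by apply: measurableI; [exact: mexc|exact: mX].
Qed.

End last_exit_decomposition.

(** * Boundedness in probability *)

Section tightness.
Context (R : realType) (T : pmetricType R).
Context d (Omega : measurableType d) (Pr : probability Omega R).
Variable X : nat -> {RV Pr >-> borel T}.

Lemma bounded_of_far_le (origin : T) :
  (forall e : R, (0 < e)%R -> exists L0 : R, forall L, (L0 <= L)%R ->
     forall n, Pr [set w | (L < mdist (X n w : T) origin)%R] <= e%:E) ->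
  bounded_in_probability origin X.
Proof.
move=> far_le; rewrite /bounded_in_probability; set F := fun L : R => _.
have F0 L : 0 <= F L.
  apply: (@le_trans _ _ (Pr [set w | (L < mdist (X 0%N w : T) origin)%R]))
    => //.
  by apply: ereal_sup_ubound; exists 0%N.
have F_le L e : (forall n,
    Pr [set w | (L < mdist (X n w : T) origin)%R] <= e) -> F L <= e.
  by move=> le_e; apply: ge_ereal_sup => _ [n _ <-]; exact: le_e.
have mfar L n : measurable [set w | (L < mdist (X n w : T) origin)%R].
  have := @measurable_funP _ _ _ _ setT (X n) measurableT _
    (measurable_far origin L).
  by rewrite setTI.
have F1 L : F L <= 1.
  by apply: F_le => n; exact: probability_le1.
have F_fin L : F L \is a fin_num.
  by rewrite ge0_fin_numE// (le_lt_trans (F1 L))// ltry.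
apply/fine_cvgP; split; first exact: nearW.
apply/cvgrPdist_le => e e0; have [L0 HL0] := far_le e e0.
near=> L; rewrite sub0r normrN /= ger0_norm ?fine_ge0//.
rewrite -lee_fin fineK//; apply/F_le/HL0.
by near: L; apply: nbhs_pinfty_ge; exact: num_real.
Unshelve. all: by end_near. Qed.

End tightness.

Theorem theorem5 (R : realType) (T : pmetricType R) (origin : T)
  (P : R.-pker (borel T) ~> (borel T)) (pi : probability (borel T) R)
  (D : R) (K : set T) (x0 : T)
  (d : measure_display) (Omega : measurableType d) (Pr : probability Omega R)
  (X : nat -> {RV Pr >-> borel T})
  (mu nu : probability (borel T) R) (M : R)
  (P_ergodic : harris_ergodic P pi)
  (P_step : forall x : T, P x [set y : T | (mdist x y <= D)%R] = 1)
  (K_meas : measurable (K : set (borel T)))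
  (K_bounded : metric_bounded K)
  (K_x0 : K x0)
  (X_adv : adversarial_chain P D K x0 X)
  (mu_conc : mu (shell K D (2 * D)) = 1)
  (A1 : forall (x : T) (A : set (borel T)),
      (thickening K D `\` K) x -> measurable A ->
      A `<=` shell K D (2 * D) ->
      P x A <= M%:E * mu A)
  (A3 : small_with P (shell K D (2 * D)) nu)
  (pi_shell : 0 < pi (shell K D (2 * D)))
  (A4 : (forall A : set (borel T), measurable A -> nu A = mu A) \/
        (reversible P pi /\
         forall A : set (borel T), measurable A ->
           mu A = normalized_restriction pi (shell K D (2 * D)) A)) :
  bounded_in_probability origin X.
Proof.
have stat := P_ergodic.1.
have K0 : K !=set0 by exists x0.
have D0 : (0 <= D)%R.
  rewrite leNgt; apply/negP => D0; have := P_step x0.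
  rewrite (_ : [set y | _] = set0) ?measure0.
    by move/eqP; rewrite eq_sym onee_eq0.
  rewrite -subset0 => y /= /le_lt_trans/(_ D0).
  by rewrite ltNge mdist_ge0.
pose B : set (borel T) := thickening K D.
pose C : set (borel T) := shell K D (2 * D).
have mB : measurable B by exact: measurable_thickening.
have mC : measurable C.
  by apply: measurableD => //; exact: measurable_thickening.
have KB : K `<=` B by exact: sub_thickening.
have CB : C `<=` ~` B by move=> x [].
have B_exit x : (B `\` K) x -> P x (~` (B `|` C)) = 0.
  move=> [Bx _].
  pose E : set (borel T) := [set y : T | (D < mdist y x)%R].
  have mE : measurable E by exact: measurable_far.
  have PE : P x E = 0.
    apply: kernel_full_setC => //; rewrite -(P_step x); congr (P x _).
    by apply/seteqP; split => y /=; rewrite metric_sym leNgt => /negP.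
  apply/le_anti/andP; split => //; rewrite -PE.
  apply: le_measure => [||y /not_orP[nBy nCy]].
  - exact/mem_set/measurableC/measurableU.
  - exact: mem_set.
  rewrite /E /= ltNge; apply/negP => yx; apply: nCy; split => //.
  rewrite mulr_natl mulr2n; apply: (thickening_step K0 Bx).
  by rewrite metric_sym.
(* a negative [M] is possible only if [B `\` K] is empty *)
pose M' := Num.max M 0%R.
have M'0 : (0 <= M')%R by rewrite le_max lexx orbT.
have P_le_mu x (A : set (borel T)) : (B `\` K) x -> measurable A -> A `<=` C ->
    P x A <= M'%:E * mu A.
  move=> BKx mA sAC; apply: le_trans (A1 _ _ BKx mA sAC) _.
  by apply: lee_wpmul2r => //; rewrite lee_fin le_max lexx.
have mu_small : small_with P C mu.
  case: A4 => [numu|[rev muE]]; last first.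
    exact: reversible_small rev pi_shell muE A3.
  have [eps eps0 [n0 nu_small]] := A3.
  by exists eps => //; exists n0 => x A Cx mA; rewrite -numu// nu_small.
have [G G0 mu_pi] := small_dominated stat mC pi_shell mu_small.
have dmu := daniell_integral mu measurableT.
pose exc := excursion K X B C.
have exc_pi k j (A : set (borel T)) : measurable A ->
    Pr (exc k j `&` X (j.+1 + k)%N @^-1` A) <= (M' * G)%:E * pi A.
  move=> mA; have nA := nnmeas_ind R mA.
  apply: le_trans (excursion_mass_le X_adv K_meas mB mC KB CB M'0 P_le_mu
    _ _ mA) _.
  rewrite EFinM -muleA; apply: lee_wpmul2l; first by rewrite lee_fin.
  rewrite -(integral_ind pi)//; apply: le_trans (mu_pi _ j nA).
  apply: (daniell_mono dmu) => [||x].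
  - exact: nnmeas_iter_killed_op.
  - exact: nnmeas_iter_kernel_op.
  - exact: iter_killed_op_le.
have tight : tight_excursions K X B C.
  have [piB|] := ltP 0 (pi B).
    have [c hit] := small_measure_hitting P_ergodic mB mC piB pi_shell mu_small.
    pose s j := M'%:E * \int[mu]_x iter j (killed_op P B) (fun=> 1) x.
    have s0 j : 0 <= \int[mu]_x iter j (killed_op P B) (fun=> 1) x.
      by apply: (daniell_ge0 dmu); exact: nnmeas_iter_killed_op.
    apply: (tight_of_short_excursions X_adv K_meas mB mC (KB _ K_x0) _ B_exit
      (s := s)) => //.
    - apply: (@bounded_sums_small_tails _ _ (M' * c)) => [j|N].
        by rewrite /s mule_ge0// lee_fin.
      rewrite -ge0_sume_distrr//.
      by rewrite EFinM; apply: lee_wpmul2l => //; rewrite lee_fin.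
    - move=> k j; have := excursion_mass_le X_adv K_meas mB mC KB CB M'0
        P_le_mu k j measurableT.
      rewrite preimage_setT setIT /s (_ : ind setT = fun=> 1)//.
      by apply/funext => x; rewrite ind_in.
  (* [mu] is dominated by [pi], so from [mu] the chain never enters a
     [pi]-null set *)
  rewrite le_eqVlt ltNge measure_ge0 orbF => /eqP piB.
  apply: (tight_of_few_excursions X_adv K_meas mB mC CB (KB _ K_x0) _ B_exit)
    => //.
  move=> k j.
  apply: (excursion_never_returns X_adv K_meas mB mC KB CB M'0 P_le_mu).
  move=> i; apply/le_anti/andP; split.
    apply: le_trans (mu_pi _ i (nnmeas_ind R mB)) _.
    by rewrite integral_ind// [X in _ * X]piB mule0.
  by apply: (daniell_ge0 dmu); exact/nnmeas_iter_kernel_op/nnmeas_ind.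
have [Lb B_Lb] := metric_bounded_thickening D origin K0 K_bounded.
apply: bounded_of_far_le => e e0.
have [J HJ] := tight (e / 2)%R (divr_gt0 e0 (ltr0Sn _ _)).
pose a := (J%:R * (M' * G))%R.
have a0 : (0 <= a)%R by rewrite !mulr_ge0.
(* [pi (A)] is made so small that [J] excursions contribute at most [e / 2];
   the summand 1 avoids a division by 0 *)
have [m far_m] := cvg0_small (far_measure_cvg0 pi origin)
  (divr_gt0 (divr_gt0 e0 (ltr0Sn R 1)) (ltr_wpDl a0 ltr01)).
exists (Num.max Lb m%:R) => L; rewrite ge_max => /andP[LbL mL] n.
pose A : set (borel T) := [set x : T | (L < mdist x origin)%R].
have mA : measurable A by exact: measurable_far.
pose p := fine (pi A); have pE : pi A = p%:E by rewrite fineK ?fin_num_measure.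
have p0 : (0 <= p)%R by rewrite -lee_fin -pE.
have p_le : (p <= e / 2 / (a + 1))%R.
  rewrite -lee_fin -pE; apply: le_trans far_m.
  apply: le_measure => [||x]; [exact: mem_set| |].
    by apply: mem_set; exact: measurable_far.
  by rewrite /A /=; exact: le_lt_trans.
apply: le_trans (HJ (M' * G * p)%R A _ mA _ _ n) _.
- by rewrite !mulr_ge0.
- by move=> x Ax /B_Lb; rewrite leNgt => /negP; apply; exact: le_lt_trans Ax.
- by move=> k j; rewrite EFinM -pE; exact: exc_pi.
rewrite lee_fin mulrA -/a; move: p_le; rewrite ler_pdivlMr ?ltr_wpDl//.
by nra.
Qed.
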